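(* Let $f$ be a Z-stable mapping of a complete metric space $X$ into a normed space $Y$. Then $f$ is well behaved.
   Context: The setting is Bishop-style constructive mathematics (BISH): intuitionistic logic together with dependent choice; neither the law of excluded middle, nor LPO, nor Markov's principle may be used. $\rho$ denotes the metric on $X$. For elements $x,y$ of a metric space, $x\neq y$ means $\rho(x,y)>0$; in particular, $f(x)\neq0$ means $\|f(x)\|>0$. For $x\in X$, $S\subset X$ and $\varepsilon>0$, the expression $\rho(x,S)<\varepsilon$ means that there exists $y\in S$ with $\rho(x,y)<\varepsilon$. The zero set of $f$ is $Z_f=\{x\in X:f(x)=0\}$, and its complement in $X$ is $\mathord{\sim}Z_f=\{y\in X:\forall_{z\in Z_f}\,(y\neq z)\}$. The mapping $f$ is well behaved if $f(x)\neq0$ for each $x\in\mathord{\sim}Z_f$. The mapping $f$ is Z-stable if for each $x\in X$ and each $\varepsilon>0$ there exists $\delta>0$ such that if $\|f(x)\|<\delta$, then $\rho(x,Z_f)<\varepsilon$. *)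

(* Defs.v *)
From Stdlib Require Import RelationClasses Morphisms.
From Stdlib Require Import ConstructiveReals.

(** Bishop-style constructive analysis over the constructive reals of the
    standard library.  Propositions with computational content (strict
    inequalities, existence statements) live in [Set]/[Type], i.e. are read as
    propositions-as-types: [CRlt] is [Set]-valued and "there exists" is a sigma
    type.  Under this reading dependent choice holds without axioms.
    [CRle], [CReq] and the setoid equalities are negative, hence in [Prop]. *)

Local Open Scope ConstructiveReals.

Record MetricSpace (R : ConstructiveReals) : Type := {
  ms_car :> Type;
  ms_eq : ms_car -> ms_car -> Prop;
  dist : ms_car -> ms_car -> CRcarrier R;
  ms_eq_equiv : Equivalence ms_eq;
  dist_ge0 : forall x y, 0 <= dist x y;
  dist_eq0 : forall x y, dist x y == 0 <-> ms_eq x y;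
  dist_sym : forall x y, dist x y == dist y x;
  dist_triangle : forall x y z, dist x z <= dist x y + dist y z
}.

Arguments ms_car {R}.
Arguments ms_eq {R m}.
Arguments dist {R m}.

(** A complex normed space is covered through restriction of scalars. *)
Record NormedSpace (R : ConstructiveReals) : Type := {
  ns_car :> Type;
  ns_eq : ns_car -> ns_car -> Prop;
  vzero : ns_car;
  vadd : ns_car -> ns_car -> ns_car;
  vopp : ns_car -> ns_car;
  vscale : CRcarrier R -> ns_car -> ns_car;
  norm : ns_car -> CRcarrier R;
  ns_eq_equiv : Equivalence ns_eq;
  vadd_proper : Proper (ns_eq ==> ns_eq ==> ns_eq) vadd;
  vopp_proper : Proper (ns_eq ==> ns_eq) vopp;
  vscale_proper : Proper (CReq R ==> ns_eq ==> ns_eq) vscale;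
  norm_proper : Proper (ns_eq ==> CReq R) norm;
  vadd_assoc : forall u v w, ns_eq (vadd u (vadd v w)) (vadd (vadd u v) w);
  vadd_comm : forall u v, ns_eq (vadd u v) (vadd v u);
  vadd_0_l : forall u, ns_eq (vadd vzero u) u;
  vadd_opp_r : forall u, ns_eq (vadd u (vopp u)) vzero;
  vscale_1 : forall u, ns_eq (vscale 1 u) u;
  vscale_mult : forall a b u,
    ns_eq (vscale a (vscale b u)) (vscale (a * b) u);
  vscale_plus : forall a b u,
    ns_eq (vscale (a + b) u) (vadd (vscale a u) (vscale b u));
  vscale_add : forall a u v,
    ns_eq (vscale a (vadd u v)) (vadd (vscale a u) (vscale a v));
  norm_ge0 : forall u, 0 <= norm u;
  norm_eq0 : forall u, norm u == 0 <-> ns_eq u vzero;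
  norm_scale : forall a u, norm (vscale a u) == CRabs R a * norm u;
  norm_triangle : forall u v, norm (vadd u v) <= norm u + norm v
}.

Arguments ns_car {R}.
Arguments ns_eq {R n}.
Arguments vzero {R n}.
Arguments vadd {R n}.
Arguments vopp {R n}.
Arguments vscale {R n}.
Arguments norm {R n}.

Section Metric.

Context {R : ConstructiveReals} {X : MetricSpace R}.

Definition apart (x y : X) : Set := 0 < dist x y.

Definition is_cauchy (u : nat -> X) : Type :=
  forall eps : CRcarrier R, 0 < eps ->
    { N : nat | forall m n : nat, le N m -> le N n -> dist (u m) (u n) <= eps }.

Definition converges_to (u : nat -> X) (l : X) : Type :=
  forall eps : CRcarrier R, 0 < eps ->
    { N : nat | forall n : nat, le N n -> dist (u n) l <= eps }.

Definition dist_set_lt (x : X) (S : X -> Prop) (eps : CRcarrier R) : Type :=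
  { y : X & prod (S y) (dist x y < eps) }.

Definition set_complement (S : X -> Prop) (y : X) : Type :=
  forall z : X, S z -> apart y z.

End Metric.

Definition complete {R : ConstructiveReals} (X : MetricSpace R) : Type :=
  forall u : nat -> X, is_cauchy u -> { l : X & converges_to u l }.

Record Mapping {R : ConstructiveReals} (X : MetricSpace R) (Y : NormedSpace R)
  : Type := {
  map_fun :> X -> Y;
  map_ext : forall x y : X, ms_eq x y -> ns_eq (map_fun x) (map_fun y)
}.

Section Mappings.

Context {R : ConstructiveReals} {X : MetricSpace R} {Y : NormedSpace R}.

Definition zero_set (f : Mapping X Y) (x : X) : Prop := ns_eq (f x) vzero.

Definition nonzero (v : Y) : Set := 0 < norm v.

Definition well_behaved (f : Mapping X Y) : Type :=
  forall x : X, set_complement (zero_set f) x -> nonzero (f x).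

Definition Z_stable (f : Mapping X Y) : Type :=
  forall (x : X) (eps : CRcarrier R), 0 < eps ->
    { delta : CRcarrier R &
      prod (0 < delta)
           (norm (f x) < delta -> dist_set_lt x (zero_set f) eps) }.

End Mappings.

(* Main.v *)
Require Import Defs.
From Stdlib Require Import ConstructiveReals.
From Stdlib Require Import QArith Arith Lia.

(** Let [x] be apart from every zero of [f], and let [r n] decrease to [0].
    By Z-stability and cotransitivity, for each [n] either [0 < norm (f x)], or
    [norm (f x) < r n] and some zero [z n] lies within [r n] of [x].  Let
    [u n = z n], except that [u] is frozen as soon as the first alternative has
    been chosen once.  Then [u] is a Cauchy sequence of zeros, so it has a limit
    [l].  No continuity of [f] is available, but [l] is still a zero: otherwise
    [u] is never frozen, so that [x = l] and [f x = 0].  Hence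
    [0 < dist x l], and if [r n < dist x l] then [u] must be frozen by
    stage [n], that is [0 < norm (f x)]. *)

Local Open Scope ConstructiveReals.

Section Freezing.

Context {T : Type} {P : Type} {A : nat -> T -> Type}.
Variables (t0 : T) (choose : forall n, P + { z : T & A n z }).

Definition advance (n : nat) (old : T) : { z : T & (P + A n z)%type } :=
  match choose n with
  | inl p => existT _ old (inl p)
  | inr (existT _ z a) => existT _ z (inr a)
  end.

(** The state carries a tag: [inl] marks a frozen sequence and keeps its evidence for [P], [inr]
    certifies the current term. The default [t0] survives only if stage 0 already yields [P]. *)
Fixpoint freeze (n : nat) : { z : T & (P + A n z)%type } :=
  match n with
  | O => advance O t0
  | S n => match freeze n with
           | existT _ z (inl p) => existT _ z (inl p)
           | existT _ z (inr _) => advance (S n) z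
           end
  end.

Definition frozen_seq (n : nat) : T := projT1 (freeze n).

Lemma frozen_seq_step (n : nat) :
  ((frozen_seq (S n) = frozen_seq n) + A (S n) (frozen_seq (S n)))%type.
Proof.
  unfold frozen_seq; simpl.
  destruct (freeze n) as [z [p | a]]; simpl; [now left|].
  unfold advance; destruct (choose (S n)) as [p | [z' a']]; simpl; auto.
Qed.

Lemma frozen_seq_const (n : nat) (p : P) :
  projT2 (freeze n) = inl p ->
  forall m, (n <= m)%nat -> frozen_seq m = frozen_seq n.
Proof.
  intros Hp m Hm.
  (* The induction must carry the tag along with the value, since the value alone does not determine
     the next state. *)
  enough (H : { z & { q | freeze m = existT _ z (inl q) /\ z = frozen_seq n } })
    by (destruct H as [z [q [E Ez]]]; unfold frozen_seq at 1; rewrite E; exact Ez).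
  induction m as [|m IH].
  - assert (n = O) by lia; subst n.
    exists (frozen_seq O), p; unfold frozen_seq.
    destruct (freeze O) as [z s]; simpl in *; subst s; auto.
  - destruct (le_lt_dec n m) as [Hnm | Hnm].
    + destruct (IH Hnm) as [z [q [E Ez]]].
      exists z, q; simpl; rewrite E; auto.
    + assert (n = S m) by lia; subst n.
      exists (frozen_seq (S m)), p; unfold frozen_seq.
      destruct (freeze (S m)) as [z s]; simpl in *; subst s; auto.
Qed.

(** The tag at stage [n] decides. If it is [inr], each later term was either newly certified or
    copied from its predecessor, so its certificate dates from some stage [k] with [n <= k], even if
    freezing occurs in between. *)
Lemma frozen_seq_cases (n : nat) :
  ((P * (forall m, (n <= m)%nat -> frozen_seq m = frozen_seq n))
   + (forall m, (n <= m)%nat ->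
        { k : nat & ((n <= k)%nat * A k (frozen_seq m))%type }))%type.
Proof.
  destruct (projT2 (freeze n)) as [p | a] eqn:E.
  - left; split; [exact p | exact (frozen_seq_const n p E)].
  - right; intros m Hm; induction m as [|m IH].
    + assert (n = O) by lia; subst n; exists O; split; [auto | exact a].
    + destruct (le_lt_dec n m) as [Hnm | Hnm].
      * destruct (frozen_seq_step m) as [Eq | a'].
        -- rewrite Eq; exact (IH Hnm).
        -- exists (S m); split; [lia | exact a'].
      * assert (n = S m) by lia; subst n; exists (S m); split; [auto | exact a].
Qed.

End Freezing.

Section Radius.

Variable R : ConstructiveReals.

Definition radius (n : nat) : CRcarrier R := CR_of_Q R (1 # Pos.of_succ_nat n).

Lemma radius_pos (n : nat) : 0 < radius n.
Proof. apply CR_of_Q_lt; reflexivity. Qed.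

Lemma radius_antitone (n k : nat) : (n <= k)%nat -> radius k <= radius n.
Proof. intros H; apply CR_of_Q_le; unfold Qle; simpl; lia. Qed.

Lemma double_radius_small (e : CRcarrier R) :
  0 < e -> { n : nat | radius n + radius n <= e }.
Proof.
  intros He; destruct (CR_Q_dense R 0 e He) as [[a d] [Hq Hqe]].
  apply lt_CR_of_Q in Hq.
  (* As [0 < a], this index gives [2 / (2d + 1) <= 1 / d <= a / d]. *)
  exists (Pos.to_nat (2 * d)); unfold radius.
  apply CRle_trans with (CR_of_Q R (a # d)); [|now apply CRlt_asym].
  rewrite <- CR_of_Q_plus; apply CR_of_Q_le.
  rewrite Pos.of_nat_succ, Nat2Pos.inj_succ, Pos2Nat.id by lia.
  unfold Qlt in Hq; unfold Qle; simpl in *; nia.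
Qed.

Lemma radius_small (e : CRcarrier R) : 0 < e -> { n : nat & radius n < e }.
Proof.
  intros He; destruct (double_radius_small e He) as [n Hn]; exists n.
  apply CRlt_le_trans with (radius n + radius n); [|exact Hn].
  rewrite <- (CRplus_0_r (radius n)) at 1.
  apply CRplus_lt_compat_l, radius_pos.
Qed.

Lemma le_radius_le0 (a : CRcarrier R) : (forall n, a <= radius n) -> a <= 0.
Proof. intros H Ha; destruct (radius_small a Ha) as [n Hn]; exact (H n Hn). Qed.

End Radius.

Arguments radius {R}.

Lemma dist_limit_le {R : ConstructiveReals} {X : MetricSpace R}
    (u : nat -> X) (x l : X) (e : CRcarrier R) (n : nat) :
  converges_to u l ->
  (forall m, (n <= m)%nat -> dist x (u m) <= e) -> dist x l <= e.
Proof.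
  intros Hul Hu He.
  (* [He] says [e < dist x l]; a term within [radius k] of [l] contradicts it, [radius k] being
     smaller than the gap. *)
  destruct (radius_small R (dist x l - e)) as [k Hk].
  { apply (CRplus_lt_reg_l R e).
    unfold CRminus; rewrite CRplus_0_r, (CRplus_comm (dist x l)), <- CRplus_assoc.
    now rewrite CRplus_opp_r, CRplus_0_l. }
  destruct (Hul (radius k) (radius_pos R k)) as [N HN].
  assert (H : dist x l <= e + radius k).
  { apply CRle_trans with (1 := dist_triangle _ _ x (u (max n N)) l).
    apply CRplus_le_compat; [apply Hu | apply HN]; lia. }
  apply H.
  apply CRlt_le_trans with (e + (dist x l - e)).
  - now apply CRplus_lt_compat_l.
  - unfold CRminus; rewrite (CRplus_comm (dist x l)), <- CRplus_assoc.
    rewrite CRplus_opp_r, CRplus_0_l; apply CRle_refl.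
Qed.

Section WellBehaved.

Context {R : ConstructiveReals} {X : MetricSpace R} {Y : NormedSpace R}.

Definition close_zero (f : Mapping X Y) (x : X) (n : nat) (z : X) : Type :=
  (zero_set f z * (dist x z < radius n) * (norm (f x) < radius n))%type.

Lemma nonzero_or_close_zero (f : Mapping X Y) (x : X) (n : nat) :
  Z_stable f -> (nonzero (f x) + { z : X & close_zero f x n z })%type.
Proof.
  intros HZ.
  destruct (HZ x (radius n) (radius_pos R n)) as [d [Hd Hz]].
  destruct (snd (CRltLinear R) 0 (norm (f x)) d Hd) as [Hpos | Hlt]; [now left|].
  (* The comparison with [d] yields the zero; this second one yields the norm bound that makes [f x]
     vanish if freezing never happens. *)
  destruct (snd (CRltLinear R) 0 (norm (f x)) (radius n) (radius_pos R n))
    as [Hpos | Hr]; [now left|].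
  right; destruct (Hz Hlt) as [z [Hfz Hxz]]; exists z; repeat split; assumption.
Qed.

Lemma dist_refl_le (x : X) (e : CRcarrier R) : 0 < e -> dist x x <= e.
Proof.
  intros He.
  assert (E : dist x x == 0) by (apply dist_eq0, ms_eq_equiv).
  rewrite E; now apply CRlt_asym.
Qed.

Lemma norm_le0_eq0 (v : Y) : norm v <= 0 -> ns_eq v vzero.
Proof. intros H; apply norm_eq0; split; [apply norm_ge0 | exact H]. Qed.

Variables (f : Mapping X Y) (x : X) (u : nat -> X).
Hypothesis u_cases : forall n,
  ((nonzero (f x) * (forall m, (n <= m)%nat -> u m = u n))
   + (forall m, (n <= m)%nat ->
        { k : nat & ((n <= k)%nat * close_zero f x k (u m))%type }))%type.

Lemma close_zero_radius (n k : nat) (z : X) :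
  (n <= k)%nat -> close_zero f x k z ->
  dist x z <= radius n /\ norm (f x) <= radius n.
Proof.
  intros Hk [[_ Hd] Hn].
  split; (eapply CRle_trans; [apply CRlt_asym; eassumption|]);
    now apply radius_antitone.
Qed.

(** Past stage [n] the sequence is either constant or stays within [radius n] of [x], hence has
    diameter at most [radius n + radius n]. *)
Lemma frozen_zeros_cauchy : is_cauchy u.
Proof.
  intros e He; destruct (double_radius_small R e He) as [n Hn].
  exists n; intros i j Hi Hj.
  destruct (u_cases n) as [[_ Hc] | Hc].
  - rewrite (Hc i Hi), (Hc j Hj); now apply dist_refl_le.
  - destruct (Hc i Hi) as [ki [Hki Ci]], (Hc j Hj) as [kj [Hkj Cj]].
    apply CRle_trans with (2 := Hn).
    apply CRle_trans with (1 := dist_triangle _ _ (u i) x (u j)).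
    apply CRplus_le_compat.
    + rewrite dist_sym; exact (proj1 (close_zero_radius n ki _ Hki Ci)).
    + exact (proj1 (close_zero_radius n kj _ Hkj Cj)).
Qed.

Lemma frozen_limit_near (l : X) (n : nat) :
  converges_to u l ->
  (forall m, (n <= m)%nat ->
     { k : nat & ((n <= k)%nat * close_zero f x k (u m))%type }) ->
  dist x l <= radius n.
Proof.
  intros Hul Hc; apply dist_limit_le with (u := u) (n := n); [exact Hul|].
  intros m Hm; destruct (Hc m Hm) as [k [Hk C]].
  exact (proj1 (close_zero_radius n k _ Hk C)).
Qed.

Lemma frozen_limit_zero (l : X) :
  (forall n, zero_set f (u n)) -> converges_to u l -> zero_set f l.
Proof.
  (* Since [<=] is the negation of the reversed [<], assuming [0 < norm (f l)] and refuting it is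
     constructively valid. *)
  intros Hz Hul; apply norm_le0_eq0; intros Hl.
  assert (Hfree : forall n, dist x l <= radius n /\ norm (f x) <= radius n).
  { intros n; destruct (u_cases n) as [[_ Hc] | Hc].
    (* Freezing by stage [n] would make [l] equal to the zero [u n], and extensionality of [f]
       contradicts [Hl]. *)
    - exfalso.
      assert (E : ms_eq (u n) l).
      { apply dist_eq0; split; [apply dist_ge0|].
        apply dist_limit_le with (u := u) (n := n); [exact Hul|].
        intros m Hm; rewrite (Hc m Hm).
        apply (proj2 (dist_eq0 _ _ (u n) (u n))), ms_eq_equiv. }
      assert (E0 : norm (f l) == 0).
      { apply norm_eq0.
        destruct (ns_eq_equiv _ Y) as [_ Hsym Htrans].
        apply Htrans with (f (u n)); [apply Hsym, map_ext, E | apply Hz]. }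
      exact (proj2 E0 Hl).
    - split; [exact (frozen_limit_near l n Hul Hc)|].
      destruct (Hc n (le_n n)) as [k [Hk C]].
      exact (proj2 (close_zero_radius n k _ Hk C)). }
  assert (E : ms_eq l x).
  { apply (Equivalence_Symmetric (Equivalence := ms_eq_equiv _ X)).
    apply dist_eq0; split; [apply dist_ge0|].
    apply le_radius_le0; intros n; apply Hfree. }
  assert (Hx : ns_eq (f x) vzero).
  { apply norm_le0_eq0, le_radius_le0; intros n; apply Hfree. }
  assert (E0 : norm (f l) == 0).
  { apply norm_eq0.
    destruct (ns_eq_equiv _ Y) as [_ _ Htrans].
    apply Htrans with (f x); [apply map_ext, E | exact Hx]. }
  exact (proj2 E0 Hl).
Qed.

End WellBehaved.

Theorem proposition2p2 (R : ConstructiveReals) (X : MetricSpace R)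
    (Y : NormedSpace R) (f : Mapping X Y) :
  complete X -> Z_stable f -> well_behaved f.
Proof.
  intros HX HZ x Hx.
  pose (u := frozen_seq x (fun n => nonzero_or_close_zero f x n HZ)).
  pose proof (frozen_seq_cases x (fun n => nonzero_or_close_zero f x n HZ))
    as Hu; fold u in Hu.
  destruct (Hu O) as [[Hpos _] | Hall]; [exact Hpos|].
  assert (Hz : forall n, zero_set f (u n)).
  { intros n; destruct (Hall n (Nat.le_0_l n)) as [k [_ [[H _] _]]]; exact H. }
  destruct (HX u (frozen_zeros_cauchy f x u Hu)) as [l Hl].
  pose proof (Hx l (frozen_limit_zero f x u Hu l Hz Hl)) as Hxl.
  destruct (radius_small R (dist x l) Hxl) as [n Hn].
  destruct (Hu n) as [[Hpos _] | Hc]; [exact Hpos|].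
  destruct (frozen_limit_near f x u l n Hl Hc Hn).
Qed.
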